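(* Let $\varphi:(0,\infty)\to(0,\infty)$ be self-equivarying ($\varphi\in SE$) with $\eta$-index $\rho=\rho_\varphi$, and suppose $1/\varphi$ is locally integrable on $[0,\infty)$. Let $U:(0,\infty)\to\mathbb{R}$ and $c_U\in\mathbb{R}$. Put $\tau_\varphi(x):=\int_0^x \mathrm{d}w/\varphi(w)$, $V:=U\circ\tau_\varphi^{-1}$ and $g(y):=\varphi(\tau_\varphi^{-1}(y))$. Then $$\frac{U(x+t\varphi(x))-U(x)}{\varphi(x)}\to c_U\,t\quad\text{as }x\to\infty,\ \text{for all }t\ge 0,$$ if and only if $$\frac{V(y+s)-V(y)}{g(y)}\to c_U\,H_\rho(s)\quad\text{as }y\to\infty,\ \text{for all }s\ge 0,$$ the convergence being understood in both cases as locally uniform (in $t\ge0$, respectively in $s\ge0$).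
   Context: A function $\varphi:(0,\infty)\to(0,\infty)$ is self-equivarying, written $\varphi\in SE$, if $\varphi(x)=O(x)$ as $x\to\infty$ and there is a function $\eta=\eta^\varphi:[0,\infty)\to(0,\infty)$ such that $\varphi(x+t\varphi(x))/\varphi(x)\to\eta(t)$ as $x\to\infty$, locally uniformly in $t\in[0,\infty)$. It is known that then $\eta(t)=1+\rho t$ for some $\rho\ge 0$; this $\rho=\rho_\varphi$ is called the $\eta$-index of $\varphi$. $H_\rho(s):=(e^{\rho s}-1)/\rho$ for $\rho>0$, and $H_0(s):=s$. The function $\tau_\varphi$ is strictly increasing; $\tau_\varphi^{-1}$ denotes its inverse function. The circle in $U\circ\tau_\varphi^{-1}$ denotes composition of functions. *)

(* Defs.v *)
From HB Require Import structures.
From mathcomp Require Import all_boot all_order all_algebra.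
From mathcomp Require Import all_classical all_reals all_analysis.
Set Implicit Arguments.
Unset Strict Implicit.
Unset Printing Implicit Defensive.
Import Order.TTheory GRing.Theory Num.Theory.
Import numFieldNormedType.Exports.
Local Open Scope classical_set_scope.
Local Open Scope ring_scope.

(* Functions on (0, +oo) or [0, +oo) are total functions on R; only their
   values on the half-line are used. *)

(* [F x t --> G t] as [x --> +oo], locally uniformly in [t >= 0]: as [0, +oo[
   is locally compact, this is uniform convergence on its compact subsets. *)
Definition loc_unif_cvg (R : realType) (F : R -> R -> R) (G : R -> R) : Prop :=
  {family compactly_in (`[0, +oo[ : set R), F x @[x --> +oo] --> G}.

Definition is_eta (R : realType) (phi eta : R -> R) : Prop :=
  loc_unif_cvg (fun x t => phi (x + t * phi x) / phi x) eta.

(* [FilterType] because [pinfty_nbhs] has no canonical [filter_on] structure. *)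
Definition self_equivarying (R : realType) (phi : R -> R) : Prop :=
  phi =O_ (FilterType (pinfty_nbhs R) _) id /\
  exists eta : R -> R, (forall t, 0 <= t -> 0 < eta t) /\ is_eta phi eta.

(* Every limit [eta] of a self-equivarying function has the form [1 + rho * t]
   on [0, +oo[; its slope [rho] is the index. *)
Definition is_eta_index (R : realType) (phi : R -> R) (rho : R) : Prop :=
  0 <= rho /\ is_eta phi (fun t => 1 + rho * t).

(* The library's [locally_integrable] is restricted to open domains.  The value
   of [f] at [0] is irrelevant, since singletons are Lebesgue-null. *)
Definition loc_integrable0y (R : realType) (f : R -> R) : Prop :=
  forall K : set R, compactly_in (`[0, +oo[ : set R) K ->
    lebesgue_measure.-integrable K (EFin \o f).

Definition tau (R : realType) (phi : R -> R) (x : R) : R :=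
  \int[lebesgue_measure]_(w in `[0, x]) (phi w)^-1.

Definition tau_inv (R : realType) (phi : R -> R) : R -> R :=
  pinv (`]0, +oo[ : set R) (tau phi).

Definition Hrho (R : realType) (rho s : R) : R :=
  if rho == 0 then s else (expR (rho * s) - 1) / rho.

(* Main.v *)
Require Import Defs.
From HB Require Import structures.
From mathcomp Require Import all_boot all_order all_algebra.
From mathcomp Require Import all_classical all_reals all_analysis.
From mathcomp Require Import ring lra.
Set Implicit Arguments.
Unset Strict Implicit.
Unset Printing Implicit Defensive.
Import Order.TTheory GRing.Theory Num.Theory.
Import numFieldNormedType.Exports.
Local Open Scope classical_set_scope.
Local Open Scope ring_scope.

(** The map [tau] straightens the self-equivarying flow.  Write
    [s = tau (x + t * phi x) - tau x] for the travel time from [x] to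
    [x + t * phi x].  After the substitution [w = x + u * phi x],
      [s = \int_0^t phi x / phi (x + u * phi x) du],
    whose integrand tends to [1 / (1 + rho * u)] uniformly for [u] in compact
    sets; so [s] tends to [ln (1 + rho * t) / rho], the inverse function of
    [Hrho rho] at [t], and [t] is close to [Hrho rho s].  With [y = tau x], the
    difference quotient of [U] at [(x, t)] is exactly the difference quotient
    of [V] at [(y, s)], and [x] tends to infinity if and only if [y] does.
    The two convergence statements therefore differ only by replacing
    [cU * t] with [cU * Hrho rho s].

    The limit of [s] is obtained without substitution in the integral: on
    [[x, x + t * phi x]] the function [phi] is within a factor [1 +- e] of the
    affine function [w |-> phi x + rho * (w - x)], because
    [1 + rho * u >= 1] turns the uniform error in the definition of
    self-equivariance into a relative one.  The reciprocal of the affine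
    function has a closed integral ([Rintegral_inv_affine]), so [s] is within
    the same relative error of its limit ([tau_increment_bounds]), and the
    Lipschitz continuity of [Hrho rho] gives [t] close to [Hrho rho s]
    ([tau_increment]).

    To pass between the variables, [tau] has to be a bijection near infinity.
    It is strictly increasing since [1 / phi > 0], and continuous as an
    integral with variable upper end.  It is unbounded because the travel time
    over [t * phi x] is, for [x] large, at least half of
    [ln (1 + rho * t) / rho], which can be made arbitrarily large by the choice
    of [t] ([tau_unbounded]). *)

(** * Locally uniform convergence on the half-line *)

(** Compact subsets of [[0, +oo[] are exactly the ones inside some compact
    interval [[0, T]], so that the topology of compact convergence amounts to
    uniform estimates on these intervals. *)
Lemma loc_unif_cvgP (R : realType) (F : R -> R -> R) (G : R -> R) :
  loc_unif_cvg F G <->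
  forall T e : R, 0 < e -> exists X, forall x, X < x ->
    forall t, 0 <= t <= T -> `|F x t - G t| < e.
Proof.
apply: (iff_trans (fam_cvgP _ _ _)); split.
- move=> FG T e e0.
  have /FG/(_ [set h : R -> R | forall t, 0 <= t <= T -> `|h t - G t| < e]) :
      compactly_in (`[0, +oo[ : set R) [set` `[0, T]].
    split; last exact: segment_compact.
    by move=> t /=; rewrite !in_itv/= => /andP[->].
  case.
    apply/uniform_nbhs; exists [set p : R * R | `|p.1 - p.2| < e]; split.
      exact: entourage_ball (PosNum e0).
    by move=> h hG t t0T; rewrite distrC; apply: hG; rewrite /= in_itv.
  by move=> X [_ FX]; exists X.
- move=> FG K [K0 Kc] P /uniform_nbhs[E [+ EP]].
  rewrite -entourage_ballE => -[e /= e0 eE].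
  have [M [_ MK]] := compact_bounded Kc.
  have [X FX] := FG (M + 1) e e0.
  exists X; split; first exact: num_real.
  move=> x Xx; apply: EP => t Kt; apply: eE.
  rewrite /ball/= distrC; apply: FX => //.
  have := K0 _ Kt; rewrite /= in_itv/= andbT => t0; rewrite t0/=.
  have := MK (M + 1) _ t Kt; rewrite ltrDl ltr01 => /(_ isT).
  by apply: le_trans; rewrite ler_norm.
Qed.

(** * The function [Hrho] and its inverse *)

Definition Hrho_inv (R : realType) (rho t : R) : R :=
  if rho == 0 then t else ln (1 + rho * t) / rho.

Section Hrho.
Variables (R : realType) (rho : R).
Hypothesis rho_ge0 : 0 <= rho.

Lemma Hrho_ge0 s : 0 <= s -> 0 <= Hrho rho s.
Proof.
move=> s0; rewrite /Hrho; case: eqVneq => // rho0.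
rewrite divr_ge0// subr_ge0 -[leLHS]expR0 ler_expR; exact: mulr_ge0.
Qed.

Lemma HrhoK : cancel (Hrho rho) (Hrho_inv rho).
Proof.
move=> s; rewrite /Hrho /Hrho_inv; case: eqVneq => // rho0.
by rewrite [rho * (_ / _)]mulrC divfK// addrC subrK expRK [_ * s]mulrC mulfK.
Qed.

Lemma Hrho_invK t : 0 <= t -> Hrho rho (Hrho_inv rho t) = t.
Proof.
move=> t0; rewrite /Hrho /Hrho_inv; case: eqVneq => // rho0.
rewrite [rho * (_ / _)]mulrC divfK// lnK ?posrE ?ltr_pwDl ?mulr_ge0//.
by rewrite addrC addKr [_ * t]mulrC mulfK.
Qed.

Lemma Hrho_inv_ge0 t : 0 <= t -> 0 <= Hrho_inv rho t.
Proof.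
move=> t0; rewrite /Hrho_inv; case: eqVneq => // rho0.
by rewrite divr_ge0// ln_ge0// lerDl mulr_ge0.
Qed.

Lemma Hrho_inv_le t : 0 <= t -> Hrho_inv rho t <= t.
Proof.
move=> t0; rewrite /Hrho_inv; case: eqVneq => // rho0.
rewrite ler_pdivrMr ?lt_neqAle ?rho_ge0 1?eq_sym ?rho0// [leRHS]mulrC.
by rewrite le_ln1Dx// (lt_le_trans _ (mulr_ge0 rho_ge0 t0))// ltrN10.
Qed.

(** The derivative [expR (rho * s)] of [Hrho rho] is at most [expR (rho * S)]
    on [s <= S].  The estimate comes from
    [1 - expR (- rho * (a - b)) <= rho * (a - b)] for [b <= a]. *)
Lemma Hrho_lipschitz S a b : a <= S -> b <= S ->
  `|Hrho rho a - Hrho rho b| <= expR (rho * S) * `|a - b|.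
Proof.
wlog ba : a b / b <= a.
  move=> wl aS bS; have /orP[ba|ab] := le_total b a; first exact: wl.
  by rewrite distrC [in leRHS]distrC wl.
move=> aS _; rewrite /Hrho; case: eqVneq => [->|rho0].
  by rewrite mul0r expR0 mul1r.
have rgt0 : 0 < rho by rewrite lt_neqAle eq_sym rho0.
rewrite -mulrBl opprB addrA subrK normrM [`|rho^-1|]gtr0_norm ?invr_gt0//.
rewrite ler_pdivrMr// ger0_norm ?subr_ge0 ?ler_expR ?ler_wpM2l//.
rewrite (ger0_norm (x := a - b)) ?subr_ge0//.
apply: (@le_trans _ _ (expR (rho * a) * ((a - b) * rho))).
  have -> : expR (rho * b) = expR (rho * a) * expR (rho * (b - a)).
    by rewrite -expRD; congr expR; ring.
  rewrite -[X in X - _]mulr1 -mulrBr ler_pM2l ?expR_gt0//.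
  by have := expR_ge1Dx (rho * (b - a)); lra.
by rewrite -mulrA ler_wpM2r ?mulr_ge0 ?subr_ge0// ler_expR ler_wpM2l.
Qed.


Lemma derive1_ln_affine a c w : 0 < c + rho * (w - a) -> rho != 0 ->
  is_derive w 1 (fun w => ln (c + rho * (w - a)) / rho)
                (c + rho * (w - a))^-1.
Proof.
move=> w_gt0 rho0.
have dlin : is_derive w 1 (fun w : R => c + rho * (w - a)) rho.
  by apply: is_derive_eq; rewrite /GRing.scale/=; ring.
have dln := @is_derive1_comp _ (@ln R) (fun w => c + rho * (w - a)) w _ _ (is_derive1_ln w_gt0) dlin.
have -> : (fun w => ln (c + rho * (w - a)) / rho) =
          rho^-1 *: (@ln R \o (fun w => c + rho * (w - a))).
  by apply/funext => v; rewrite /= mulrC.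
by apply: is_derive_eq; rewrite /GRing.scale/= mulrCA mulVf ?mulr1.
Qed.

Lemma continuous_inv_affine a b c : 0 < c ->
  {within `[a, b], continuous (fun w => (c + rho * (w - a))^-1)}.
Proof.
move=> c0; apply: continuous_in_subspaceT => w; rewrite inE/= in_itv/=.
move=> /andP[aw _].
apply: cvgV; first by rewrite gt_eqF// ltr_pwDl// mulr_ge0// subr_ge0.
apply: cvgD; first exact: cvg_cst.
by apply: cvgMr; apply: cvgB; [exact: cvg_id | exact: cvg_cst].
Qed.

(** The travel time for the model case where [phi] is affine: this is where the
    logarithm, and hence [Hrho], comes from. *)
Lemma Rintegral_inv_affine a c t : 0 < c -> 0 <= t ->
  \int[lebesgue_measure]_(w in `[a, a + t * c]) (c + rho * (w - a))^-1 =
  Hrho_inv rho t.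
Proof.
move=> c0; rewrite le_eqVlt => /predU1P[<-|t0].
  rewrite mul0r addr0 set_itv1 Rintegral_set1 /Hrho_inv mulr0 addr0 ln1 mul0r.
  by case: ifP.
have tc0 : 0 < t * c by rewrite mulr_gt0.
rewrite /Hrho_inv; case: eqVneq => [->|rho0].
  under eq_Rintegral do rewrite mul0r addr0.
  rewrite Rintegral_cst//= lebesgue_measure_itv/= lte_fin ltrDl tc0.
  by rewrite -EFinD/= addrAC subrr add0r mulrC mulfK// gt_eqF.
have den_gt0 w : a <= w -> 0 < c + rho * (w - a).
  by move=> aw; rewrite ltr_pwDl// mulr_ge0// subr_ge0.
have F' w : a <= w -> _ := fun aw => derive1_ln_affine (den_gt0 w aw) rho0.
have F'c w : a <= w -> {for w, continuous (fun w => ln (c + rho * (w - a)) / rho)}.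
  move=> aw; apply: differentiable_continuous; apply/derivable1_diffP.
  by case: (F' w aw).
rewrite /Rintegral (@continuous_FTC2 _ _ (fun w => ln (c + rho * (w - a)) / rho)).
- rewrite -EFinB/= subrr mulr0 addr0 -mulrBl -ln_div ?posrE//; last first.
    by rewrite den_gt0// lerDl ltW.
  by congr (ln _ / _); field; rewrite gt_eqF.
- by rewrite ltrDl.
- exact: continuous_inv_affine.
- split.
  + move=> w; rewrite in_itv/= => /andP[/ltW aw _].
    by case: (F' w aw).
  + by apply: cvg_at_right_filter; exact: F'c.
  + by apply: cvg_at_left_filter; apply: F'c; rewrite lerDl ltW.
- move=> w; rewrite in_itv/= => /andP[/ltW aw _].
  by rewrite derive1E; by case: (F' w aw).
Qed.

End Hrho.

(** * The travel time [tau] *)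

Section tau.
Variables (R : realType) (phi : R -> R).
Hypothesis phi_gt0 : forall x : R, 0 < x -> 0 < phi x.
Hypothesis phi_int : loc_integrable0y (fun w => (phi w)^-1).

Let phi_int_itv a b : 0 <= a ->
  lebesgue_measure.-integrable [set` `[a, b]] (EFin \o (fun w => (phi w)^-1)).
Proof.
move=> a0; apply: phi_int; split; last exact: segment_compact.
by move=> w /=; rewrite !in_itv/= => /andP[/(le_trans a0) ->].
Qed.

Lemma tauB a b : 0 <= a <= b ->
  tau phi b - tau phi a = \int[lebesgue_measure]_(w in `[a, b]) (phi w)^-1.
Proof.
move=> /andP[a0 ab]; rewrite /tau Rintegral_itvB ?bnd_simp//; last first.
  exact: phi_int_itv.
rewrite Rintegral_itv_obnd_cbnd//.
by apply: integrableS (phi_int_itv b a0) => //; exact: subset_itv_oc_cc.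
Qed.

(** A nonnegative function with zero integral vanishes almost everywhere, while
    [1 / phi] vanishes nowhere on [[a, b]], a set of positive measure. *)
Lemma tau_lt a b : 0 < a -> a < b -> tau phi a < tau phi b.
Proof.
move=> a0 ab; rewrite -subr_gt0 tauB; last by rewrite !ltW.
have inv_gt0 w : `[a, b]%classic w -> 0 < (phi w)^-1.
  rewrite /= in_itv/= => /andP[aw _].
  by rewrite invr_gt0 phi_gt0// (lt_le_trans a0).
have iab := phi_int_itv b (ltW a0).
rewrite lt_neqAle Rintegral_ge0 ?andbT; last by move=> w /inv_gt0/ltW.
apply/negP => /eqP/esym int0.
pose f : R -> \bar R := EFin \o (fun w => (phi w)^-1).
have /ae_eq_integral_abs : (\int[lebesgue_measure]_(w in `[a, b]) `|f w| = 0)%E.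
  transitivity (\int[lebesgue_measure]_(w in `[a, b]) f w)%E.
    apply: eq_integral => w; rewrite inE => /inv_gt0/ltW wge0.
    by rewrite /f gee0_abs.
  by rewrite -[LHS]fineK ?integrable_fin_num//; congr EFin.
move=> /(_ (measurable_itv _)) H.
have {H}[|N [mN N0 abN]] := H; first exact: measurable_int iab.
have : lebesgue_measure `[a, b]%classic = 0%E :> \bar R.
  apply: (subset_measure0 _ mN) => // w wab; apply: abN => /(_ wab) /= [].
  by apply/eqP; rewrite gt_eqF// inv_gt0.
by rewrite lebesgue_measure_itv/= lte_fin ab => /eqP; rewrite -EFinB eqe subr_eq0 gt_eqF.
Qed.

Lemma tau_invK x : 0 < x -> tau_inv phi (tau phi x) = x.
Proof.
move=> x0; apply: pinvKV; last by rewrite inE/= in_itv/= x0.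
move=> a b; rewrite !inE/= !in_itv/= !andbT => a0 b0 tab.
by have [/(tau_lt a0)|/(tau_lt b0)|//] := ltgtP a b; rewrite tab ltxx.
Qed.

Lemma tau_continuous a b : 0 <= a -> {within `[a, b], continuous (tau phi)}.
Proof.
move=> a0; have [ab|ba] := leP a b; last first.
  by rewrite set_itv_ge ?bnd_simp -?ltNge//; exact: continuous_subspace0.
apply: (@continuous_subspaceW _ _ _ [set` `[0, b]]).
  by move=> w /=; rewrite !in_itv/= => /andP[/(le_trans a0) ->].
apply: parameterized_integral_continuous; first exact: le_trans ab.
exact: phi_int_itv.
Qed.

(** * Asymptotics of the increments of [tau] *)

Section eta.
Variable rho : R.
Hypothesis rho_ge0 : 0 <= rho.
Hypothesis phi_eta : is_eta phi (fun t => 1 + rho * t).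

(** Integrating a relative error: [phi w] lies between [(1 - e) * d] and
    [(1 + e) * d], where [d = phi x + rho * (w - x)], and [1 / d] integrates to
    [Hrho_inv rho t]. *)
Lemma tau_increment_bounds (T e : R) : 0 < e -> exists2 X, 0 < X & forall x, X < x ->
  forall t, 0 <= t <= T ->
  let s := tau phi (x + t * phi x) - tau phi x in
  (1 - e) * s <= Hrho_inv rho t <= (1 + e) * s.
Proof.
move=> e0; have [X etaX] := (loc_unif_cvgP _ _).1 phi_eta T e e0.
exists (Num.max X 1); first by rewrite lt_max ltr01 orbT.
move=> x; rewrite gt_max => /andP[Xx x1] t /andP[t0 tT] /=.
have x0 : 0 < x := lt_trans ltr01 x1.
have p0 := phi_gt0 x0.
rewrite tauB ?(ltW x0) ?lerDl ?mulr_ge0 ?(ltW p0)//.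
rewrite -(Rintegral_inv_affine rho_ge0 x p0 t0).
have iphi := phi_int_itv (x + t * phi x) (ltW x0).
have iaff : lebesgue_measure.-integrable [set` `[x, x + t * phi x]]
    (EFin \o (fun w => (phi x + rho * (w - x))^-1)).
  apply: continuous_compact_integrable; first exact: segment_compact.
  exact: continuous_inv_affine.
have bounds w : `[x, x + t * phi x]%classic w ->
    [/\ 0 < phi w, 0 < phi x + rho * (w - x),
        (1 - e) * (phi x + rho * (w - x)) <= phi w &
        phi w <= (1 + e) * (phi x + rho * (w - x))].
  rewrite /= in_itv/= => /andP[xw wt].
  have w0 : 0 < phi w by rewrite phi_gt0// (lt_le_trans x0).
  have rw0 : 0 <= rho * (w - x) by rewrite mulr_ge0// subr_ge0.
  have d0 : 0 < phi x + rho * (w - x) by rewrite ltr_pwDl.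
  have := etaX x Xx ((w - x) / phi x).
  rewrite divfK ?gt_eqF// [x + (w - x)]addrC subrK.
  rewrite divr_ge0 ?subr_ge0 ?(ltW p0)//= => /(_ _).
  have -> : (w - x) / phi x <= T.
    by rewrite (le_trans _ tT)// ler_pdivrMr// lerBlDl.
  move=> /(_ isT).
  have -> : phi w / phi x - (1 + rho * ((w - x) / phi x)) =
            (phi w - (phi x + rho * (w - x))) / phi x by field; rewrite gt_eqF.
  rewrite normrM [`|(phi x)^-1|]gtr0_norm ?invr_gt0// ltr_pdivrMr//.
  move=> /ltW; rewrite ler_norml => /andP[lo hi].
  have ep : e * phi x <= e * (phi x + rho * (w - x)).
    by rewrite ler_pM2l// lerDl.
  by split=> //; lra.
apply/andP; split; rewrite -RintegralZl//; apply: le_Rintegral => //.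
- by apply: (eq_integrable _ _ _ _ (integrableZl _ (1 - e) iphi)).
- move=> w /bounds[w0 d0 lo _].
  by rewrite ler_pdivrMr// mulrC ler_pdivlMr.
- by apply: (eq_integrable _ _ _ _ (integrableZl _ (1 + e) iphi)).
- move=> w /bounds[w0 d0 _ hi].
  by rewrite ler_pdivlMr// mulrC ler_pdivrMr.
Qed.

(** The form in which the asymptotics are used.  Besides the approximation
    [t ~ Hrho rho s], a bound on [t] must give one on [s], and conversely: the
    first two conjuncts keep [s], respectively [t], in a compact set when the
    other variable ranges over one. *)
Lemma tau_increment (T e : R) : 0 < e -> exists2 X, 0 < X & forall x, X < x ->
  forall t, 0 <= t <= T ->
  let s := tau phi (x + t * phi x) - tau phi x in
  [/\ 0 <= s <= 2 * T, Hrho_inv rho t <= 2 * s & `|Hrho rho s - t| < e].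
Proof.
(* [S] bounds both [s] and [Hrho_inv rho t] for every [t] in [[0, T]], as long
   as the relative error [d] is at most one half; it is positive whatever [T]
   is, so that [d] is well defined. *)
move=> e0; pose S := 2 * (`|T| + 1).
have S0 : 0 < S by rewrite mulr_gt0// ltr_wpDl.
pose K := expR (rho * S).
have K0 : 0 < K := expR_gt0 _.
pose d := Num.min 2^-1 (e / (2 * K * S)).
have d0 : 0 < d by rewrite lt_min invr_gt0 ltr0n/= divr_gt0// !mulr_gt0.
have d2 : d <= 2^-1 by rewrite ge_min lexx.
have dKS : d * (K * S) <= e / 2.
  have : d <= e / (2 * K * S) by rewrite ge_min lexx orbT.
  rewrite ler_pdivlMr ?mulr_gt0//; lra.
have [X X0 bounds] := tau_increment_bounds T d0.
exists X => // x Xx t tT /=; have := bounds x Xx t tT.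
move: tT => /andP[t0 tT] /=.
set s := tau phi _ - _ => /andP[lo hi].
have L0 := Hrho_inv_ge0 rho_ge0 t0; have Lt := Hrho_inv_le rho_ge0 t0.
have TN := ler_norm T.
have s0 : 0 <= s by have := le_trans L0 hi; rewrite pmulr_rge0//; lra.
have ds : d * s <= 2^-1 * s by rewrite ler_wpM2r.
have sT : s <= 2 * T by lra.
split; [by rewrite s0|lra|].
have sS : s <= S by rewrite /S; lra.
rewrite -[X in _ - X](Hrho_invK rho_ge0 t0).
have := Hrho_lipschitz rho_ge0 sS (_ : Hrho_inv rho t <= S).
rewrite -/K => /(_ _)/le_lt_trans; apply; first by rewrite /S; lra.
apply: (@le_lt_trans _ _ (K * (d * S))).
  rewrite ler_pM2l// (@le_trans _ _ (d * s))//; last by rewrite ler_pM2l.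
  by rewrite ler_norml; apply/andP; split; lra.
by rewrite mulrCA; lra.
Qed.

(** A single step of length [t * phi x] suffices: its travel time is at least
    [Hrho_inv rho t / 2], and [t = Hrho rho (2 * M)] makes this equal to [M],
    whereas [tau x] is bounded below by [tau 1]. *)
Lemma tau_unbounded Y : exists2 x, 0 < x & Y < tau phi x.
Proof.
pose M := `|Y - tau phi 1| + 1.
have M0 : 0 < M by rewrite ltr_wpDl.
have [X X0 incr] := tau_increment (Hrho rho (2 * M)) ltr01.
pose x := X + 1.
have x0 : 0 < x by rewrite addr_gt0.
have t0 : 0 <= Hrho rho (2 * M) by rewrite Hrho_ge0// mulr_ge0// ltW.
have Xx : X < x by rewrite ltrDl.
have := incr x Xx (Hrho rho (2 * M)).
rewrite t0 lexx HrhoK// => /(_ isT)[_ hM _].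
exists (x + Hrho rho (2 * M) * phi x).
  by rewrite ltr_wpDr// mulr_ge0// ltW// phi_gt0.
have : tau phi 1 < tau phi x by rewrite tau_lt// ltrDr.
by have := ler_norm (Y - tau phi 1); rewrite /M in hM *; lra.
Qed.

(** As [tau] is continuous and unbounded, every large [y] is a value of [tau]
    at a large point, so that [tau_inv] is a genuine inverse there; this also
    says that [tau_inv y] tends to infinity with [y]. *)
Lemma tau_inv_pinfty X : exists Y, forall y, Y < y ->
  X < tau_inv phi y /\ tau phi (tau_inv phi y) = y.
Proof.
pose X' := Num.max X 1.
have X'0 : 0 < X' by rewrite lt_max ltr01 orbT.
exists (tau phi X') => y yX'.
have [b b0 yb] := tau_unbounded y.
have X'b : X' < b.
  rewrite ltNge le_eqVlt; apply/negP => /predU1P[bX'|/(tau_lt b0)].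
    by move: (lt_trans yX' yb); rewrite bX' ltxx.
  by move/lt_trans => /(_ _ yX'); rewrite ltNge (ltW yb).
have [x xX'b txy] : exists2 x, x \in `[X', b] & tau phi x = y.
  apply: IVT; [exact: ltW|exact/tau_continuous/ltW|].
  by rewrite min_l ?max_r ?(ltW yX') ?(ltW yb)//; exact/ltW/tau_lt.
have {xX'b} /andP[X'x _] : X' <= x <= b by move: xX'b; rewrite in_itv.
rewrite -txy tau_invK ?(lt_le_trans X'0)//; split => //.
have : X' < x.
  by rewrite lt_neqAle X'x andbT; apply: contraTneq yX' => ->; rewrite txy ltxx.
by apply: le_lt_trans; rewrite le_max lexx.
Qed.

End eta.
End tau.

(** * Transfer between the two difference quotients *)

Theorem theorem1 (R : realType) (phi : R -> R) (rho : R)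
    (phi_gt0 : forall x, 0 < x -> 0 < phi x)
    (phi_SE : self_equivarying phi)
    (phi_rho : is_eta_index phi rho)
    (phi_int : loc_integrable0y (fun w => (phi w)^-1))
    (U : R -> R) (cU : R) :
  let V := U \o tau_inv phi in
  let g := phi \o tau_inv phi in
  loc_unif_cvg (fun x t => (U (x + t * phi x) - U x) / phi x)
               (fun t => cU * t)
  <->
  loc_unif_cvg (fun y s => (V (y + s) - V y) / g y)
               (fun s => cU * Hrho rho s).
Proof.
move=> V g; have [rho_ge0 phi_eta] := phi_rho.
have incr := tau_increment phi_gt0 phi_int rho_ge0 phi_eta.
have inv_y := tau_inv_pinfty phi_gt0 phi_int rho_ge0 phi_eta.
(* An error [d e] on the argument costs at most [e / 2] after multiplication by
   [cU]; the other half of [e] is for the assumed convergence. *)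
pose d (e : R) := e / 2 / (`|cU| + 1).
have d_gt0 (e : R) : 0 < e -> 0 < d e by move=> e0; rewrite !divr_gt0// ltr_wpDl.
have close (e z z' : R) : 0 < e -> `|z - z'| < d e -> `|cU * z - cU * z'| < e / 2.
  move=> e0; rewrite /d ltr_pdivlMr ?ltr_wpDl// -mulrBr normrM [`|cU| * _]mulrC.
  by apply: le_lt_trans; rewrite ler_wpM2l// lerDl.
have split_e (e u v w : R) : `|u - v| < e / 2 -> `|v - w| < e / 2 -> `|u - w| < e.
  by move=> uv vw; rewrite [e]splitr (le_lt_trans (ler_distD v _ _))// ltrD.
split=> /loc_unif_cvgP cvg; apply/loc_unif_cvgP => T e e0;
  have e2 : 0 < e / 2 by rewrite divr_gt0.
(* For [s <= T] the time [t] stays below [T' := Hrho rho (2 * T)]: travelling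
   [T' * phi x] takes at least half of [Hrho_inv rho T' = 2 * T]. *)
- pose T' := Hrho rho (2 * T).
  have [X X0 incrX] := incr T' (d e) (d_gt0 e e0).
  have [X' UX'] := cvg T' _ e2.
  have [Y invY] := inv_y (Num.max X X').
  exists Y => y Yy s /andP[s0 sT].
  rewrite /V /g /=.
  have Yys : Y < y + s by rewrite ltr_wpDr.
  have [+ ty] := invY _ Yy; have [+ tys] := invY _ Yys.
  set x := tau_inv phi y in ty *; set x' := tau_inv phi (y + s) in tys *.
  rewrite !gt_max => /andP[Xx' _] /andP[Xx X'x].
  have x0 := lt_trans X0 Xx; have x'0 := lt_trans X0 Xx'.
  have p0 := phi_gt0 _ x0.
  pose t := (x' - x) / phi x.
  have x'E : x' = x + t * phi x by rewrite divfK ?gt_eqF// [x + _]addrC subrK.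
  have t0 : 0 <= t.
    rewrite divr_ge0 ?(ltW p0)// subr_ge0 leNgt; apply/negP.
    by move=> /(tau_lt phi_gt0 phi_int x'0); rewrite ty tys; lra.
  have T'0 : 0 <= T' by rewrite Hrho_ge0//; lra.
  have tT : t <= T'.
    rewrite leNgt; apply/negP => T't.
    have /(tau_lt phi_gt0 phi_int) : 0 < x + T' * phi x.
      by rewrite ltr_wpDr// mulr_ge0// ltW.
    move=> /(_ x'); rewrite x'E ltrD2l ltr_pM2r// -x'E => /(_ T't).
    have := incrX x Xx T'; rewrite T'0 lexx HrhoK => /(_ isT)[_ + _].
    by rewrite tys ty; lra.
  have tT' : 0 <= t <= T' by rewrite t0.
  have [_ _ st] := incrX x Xx t tT'.
  have := UX' x X'x t tT'; rewrite -x'E in st *.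
  move/split_e; apply; rewrite distrC; apply: close => //.
  by move: st; rewrite tys ty addrAC subrr add0r.
- have [X X0 incrX] := incr T (d e) (d_gt0 e e0).
  have [Y VY] := cvg (2 * T) _ e2.
  have [x1 x10 Yx1] := tau_unbounded phi_gt0 phi_int rho_ge0 phi_eta Y.
  exists (Num.max X x1) => x; rewrite gt_max => /andP[Xx x1x] t tT.
  have x0 := lt_trans X0 Xx.
  have p0 := phi_gt0 _ x0.
  have xt0 : 0 < x + t * phi x.
    by case/andP: tT => t0 _; rewrite ltr_wpDr// mulr_ge0// ltW.
  have [sT _ st] := incrX x Xx t tT.
  have Yx := lt_trans Yx1 (tau_lt phi_gt0 phi_int x10 x1x).
  have := VY _ Yx _ sT.
  rewrite /V /g /= [tau phi x + _]addrC subrK.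
  rewrite (tau_invK phi_gt0 phi_int xt0) (tau_invK phi_gt0 phi_int x0).
  by move/split_e; apply; apply: close.
Qed.
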